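(* Under the standing assumptions below, let $\alpha>\alpha_0=5/\sqrt8$. Then $$\eta(\sigma)=\frac\pi2-\beta\Big(\frac\pi2-\sigma\Big)+o\Big(\frac\pi2-\sigma\Big)\quad\text{as }\sigma\to\pi/2^-,$$ where $\beta=\eta'(\pi/2)$ is a constant with $\beta\in[1-\alpha_0/\alpha,\,1]$ (in particular $\beta>0$).
   Context: $L^2=L^2(0,\pi/2)$ with norm $\|f\|=\big(\int_0^{\pi/2}|f|^2\big)^{1/2}$. The kernel is $K(s,\sigma)=\log\Big|\frac{\sin(s+\sigma)}{\sin(s-\sigma)}\Big|$ and $(Hw)(\sigma)=\frac1\pi\int_0^{\pi/2}K(s,\sigma)\,w(s)\,ds$. For $\alpha>0$, $\varPhi(\zeta)(\sigma)=\frac{3}{\alpha\pi}\,\frac{\sin(\sigma+\frac13(H\zeta)(\sigma))\cot\sigma}{\exp\int_0^\sigma\zeta\,ds}$, $\sigma\in(0,\pi/2]$. Standing assumptions: $\zeta_*\in L^2$ is a non-negative solution of $\zeta_*=\varPhi(\zeta_* )$ with $\|\zeta_*\|\leqslant\frac{9\sqrt\pi}2$ and $0\le\sigma+\frac13(H\zeta_* )(\sigma)\le\pi$ for $\sigma\in(0,\pi/2)$, $\theta=\frac13H\zeta_*$, and $\eta(\sigma)=\sigma+\theta(\sigma)$ (so $\eta(\pi/2)=\pi/2$). *)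

(* Defs.v *)
From Stdlib Require Import Reals Lra List ClassicalEpsilon.
Open Scope R_scope.

Definition outer_le (A : R -> Prop) (r : R) : Prop :=
  forall eps, 0 < eps -> exists a b : nat -> R,
    (forall n, a n <= b n) /\
    (forall x, A x -> exists n, a n < x < b n) /\
    (forall N, sum_f_R0 (fun k => b k - a k) N <= r + eps).

Definition lmeasurable (A : R -> Prop) : Prop :=
  forall E r, outer_le E r ->
    exists r1 r2, outer_le (fun x => E x /\ A x) r1 /\
                  outer_le (fun x => E x /\ ~ A x) r2 /\ r1 + r2 <= r.

Definition measure_is (A : R -> Prop) (m : R) : Prop :=
  outer_le A m /\ forall r, outer_le A r -> m <= r.

Definition ind (A : R -> Prop) (x : R) : R :=
  if excluded_middle_informative (A x) then 1 else 0.

Definition simple_minorant_val (f : R -> R) (a b : R) (v : R) : Prop :=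
  exists s : list (R * (R -> Prop) * R),
    Forall (fun t => let '(c, A, m) := t in
              0 <= c /\ lmeasurable A /\ measure_is A m /\
              (forall x, A x -> a < x < b)) s /\
    (forall x, a < x < b ->
       fold_right (fun t acc => let '(c, A, _) := t in c * ind A x + acc) 0 s
       <= f x) /\
    v = fold_right (fun t acc => let '(c, _, m) := t in c * m + acc) 0 s.

(* the Lebesgue integral over (a,b) of a non-negative measurable f is finite
   and equals I *)
Definition leb_int (f : R -> R) (a b I : R) : Prop :=
  is_lub (simple_minorant_val f a b) I.

Definition measurable_on (f : R -> R) (a b : R) : Prop :=
  forall t, lmeasurable (fun x => a < x < b /\ t < f x).

Definition Kern (s sigma : R) : R :=
  ln (Rabs (sin (s + sigma) / sin (s - sigma))).

Definition alpha0 : R := 5 / sqrt 8.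

Definition left_deriv (f : R -> R) (x0 l : R) : Prop :=
  forall eps, 0 < eps -> exists delta, 0 < delta /\
    forall x, x0 - delta < x < x0 ->
      Rabs ((f x - f x0) / (x - x0) - l) < eps.

(* Main.v *)
(* With [d = PI/2 - sigma], the reflection [s -> PI/2 - s] and the mean value
   theorem give [Kern s sigma = 2 d sin s cos s / (cos s ^ 2 - sin xi ^ 2)] for
   [s < sigma] and some [0 < xi < d].  Hence [Kern s sigma / d] is at least
   [2 tan s] for [s < sigma], and at most [(1 + e) 2 tan s] for
   [s < PI/2 - M d] with [M = M(e)].  The fixed point equation gives
   [zeta <= C cot], [C = 3 / (alpha PI)], so the logarithmic singularity at
   [s = sigma] only contributes [O(d ^ 2)].  Thus [theta / d] tends to
   [I / (3 PI)], where [I] is the integral of [2 tan s * zeta s], and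
   [0 <= I <= 2 C * PI / 2 = 3 / alpha] gives the bounds on
   [beta = 1 - I / (3 PI)].
   Integrals are only compared by monotonicity and by cutting the sets of a
   simple minorant along intervals, so their additivity is never needed. *)

From Coquelicot Require Import Coquelicot.
From Stdlib Require Import Reals Lra Lia List Arith Classical ClassicalEpsilon.
(* Import order matters: [Forall] and [ind] also occur in Coquelicot and in
   [Rtopology]. *)
Require Import Defs.
Open Scope R_scope.

(** * Outer measure and simple minorants *)

Lemma outer_le_mono (A B : R -> Prop) (r r' : R) :
  (forall x, A x -> B x) -> r <= r' -> outer_le B r -> outer_le A r'.
Proof.
  intros HAB Hr HB eps Heps.
  destruct (HB eps Heps) as (a & b & Hab & Hcov & Hsum).
  exists a, b; repeat split; auto.
  intros N; specialize (Hsum N); lra.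
Qed.

(** The slack [eps] built into [outer_le] makes the set of admissible bounds closed, so an infimum
    of bounds is again a bound. *)
Lemma outer_le_approx (A : R -> Prop) (m : R) :
  (forall eps, 0 < eps -> exists r, r <= m + eps /\ outer_le A r) -> outer_le A m.
Proof.
  intros H eps Heps.
  destruct (H (eps / 2)) as (r & Hr & HA); [lra|].
  destruct (HA (eps / 2)) as (a & b & Hab & Hcov & Hsum); [lra|].
  exists a, b; repeat split; auto.
  intros N; specialize (Hsum N); lra.
Qed.

Lemma outer_le_nonneg (A : R -> Prop) (r : R) : outer_le A r -> 0 <= r.
Proof.
  intros HA. apply Rnot_lt_le; intros Hr.
  destruct (HA (- r / 2)) as (a & b & Hab & _ & Hsum); [lra|].
  specialize (Hsum O); specialize (Hab O); simpl in Hsum; lra.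
Qed.

Lemma outer_le_interval (a b : R) :
  a <= b -> outer_le (fun x => a <= x <= b) (b - a).
Proof.
  intros Hab eps Heps.
  (* Index 0 carries the whole interval, widened by [eps / 2] at each end; the other indices are
     empty intervals of length 0. *)
  exists (fun n => match n with O => a - eps / 2 | _ => 0 end),
         (fun n => match n with O => b + eps / 2 | _ => 0 end).
  split; [|split].
  - intros [|n]; lra.
  - intros x Hx; exists O; lra.
  - intros N. induction N as [|N IH]; simpl in *; lra.
Qed.

Lemma outer_le_empty (A : R -> Prop) : (forall x, ~ A x) -> outer_le A 0.
Proof.
  intros H. apply outer_le_mono with (fun x => 0 <= x <= 0) (0 - 0); [|lra|].
  - intros x Hx; destruct (H x Hx).
  - apply outer_le_interval; lra.
Qed.

(** Merges two countable covers into one, for the subadditivity of the outer measure. *)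
Definition interleave (u v : nat -> R) (n : nat) : R :=
  if Nat.even n then u (Nat.div2 n) else v (Nat.div2 n).

Lemma interleave_even (u v : nat -> R) (n : nat) : interleave u v (2 * n) = u n.
Proof. unfold interleave. now rewrite Nat.even_even, Nat.div2_double. Qed.

Lemma interleave_odd (u v : nat -> R) (n : nat) : interleave u v (S (2 * n)) = v n.
Proof.
  unfold interleave. rewrite Nat.div2_succ_double.
  replace (S (2 * n)) with (2 * n + 1)%nat by lia. now rewrite Nat.even_odd.
Qed.

Lemma sum_interleave (u v : nat -> R) (N : nat) :
  sum_f_R0 (interleave u v) (S (2 * N)) = sum_f_R0 u N + sum_f_R0 v N.
Proof.
  induction N as [|N IH].
  - simpl. unfold interleave; simpl; lra.
  - replace (S (2 * S N)) with (S (S (S (2 * N)))) by lia.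
    rewrite tech5, tech5, IH.
    replace (S (S (2 * N))) with (2 * S N)%nat by lia.
    rewrite interleave_even, interleave_odd, !tech5. lra.
Qed.

Lemma sum_nonneg_mono (u : nat -> R) (m n : nat) :
  (forall k, 0 <= u k) -> (m <= n)%nat -> sum_f_R0 u m <= sum_f_R0 u n.
Proof.
  intros Hu Hmn. induction Hmn as [|n Hmn IH]; [lra|].
  rewrite tech5. specialize (Hu (S n)); lra.
Qed.

Lemma outer_le_union (A B C : R -> Prop) (r1 r2 : R) :
  (forall x, C x -> A x \/ B x) ->
  outer_le A r1 -> outer_le B r2 -> outer_le C (r1 + r2).
Proof.
  intros HC HA HB eps Heps.
  destruct (HA (eps / 2)) as (a1 & b1 & H1 & Hc1 & Hs1); [lra|].
  destruct (HB (eps / 2)) as (a2 & b2 & H2 & Hc2 & Hs2); [lra|].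
  exists (interleave a1 a2), (interleave b1 b2).
  assert (Hle : forall n, interleave a1 a2 n <= interleave b1 b2 n).
  { intros n; unfold interleave; destruct (Nat.even n); auto. }
  split; [exact Hle|split].
  - intros x Hx. destruct (HC x Hx) as [Hx'|Hx'].
    + destruct (Hc1 x Hx') as [n Hn]; exists (2 * n)%nat.
      now rewrite !interleave_even.
    + destruct (Hc2 x Hx') as [n Hn]; exists (S (2 * n)).
      now rewrite !interleave_odd.
  - intros N.
    (* The partial sum is lengthened to index [S (2 * N)], where it holds exactly [N + 1] terms of
       each cover. *)
    apply Rle_trans
      with (sum_f_R0 (fun k => interleave b1 b2 k - interleave a1 a2 k) (S (2 * N))).
    + apply sum_nonneg_mono; [|lia]. intros k; specialize (Hle k); lra.
    + rewrite (sum_eq _ (interleave (fun k => b1 k - a1 k) (fun k => b2 k - a2 k))).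
      * rewrite sum_interleave. specialize (Hs1 N); specialize (Hs2 N); lra.
      * intros k _; unfold interleave; destruct (Nat.even k); reflexivity.
Qed.

(** [completeness] yields suprema, so the infimum of the bounds is taken as minus the supremum of
    their opposites; it is attained by [outer_le_approx]. *)
Lemma measure_is_exists (A : R -> Prop) (r : R) :
  outer_le A r -> exists m, measure_is A m.
Proof.
  intros HA.
  destruct (completeness (fun x => outer_le A (- x))) as [l [Hub Hlub]].
  - exists 0. intros x Hx. apply outer_le_nonneg in Hx; lra.
  - exists (- r). now rewrite Ropp_involutive.
  - exists (- l). split.
    + apply outer_le_approx. intros eps Heps.
      apply NNPP. intros Hno.
      assert (l <= l - eps); [|lra].
      apply Hlub. intros x Hx. apply Rnot_lt_le; intros Hlt.
      apply Hno. exists (- x). split; [lra|exact Hx].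
    + intros r' Hr'. assert (- r' <= l); [|lra].
      apply Hub. now rewrite Ropp_involutive.
Qed.

(** The outer measure as a total function. Its value is meaningful only for sets of finite outer
    measure, whence the bound [r] in the lemmas about it. *)
Definition omeas (A : R -> Prop) : R := epsilon (inhabits 0) (measure_is A).

Lemma omeas_spec (A : R -> Prop) (r : R) : outer_le A r -> measure_is A (omeas A).
Proof. intros HA. unfold omeas. apply epsilon_spec. exact (measure_is_exists A r HA). Qed.

Lemma omeas_le (A : R -> Prop) (r : R) : outer_le A r -> omeas A <= r.
Proof. intros HA. destruct (omeas_spec A r HA) as [_ H]. now apply H. Qed.

Lemma omeas_outer (A : R -> Prop) (r : R) : outer_le A r -> outer_le A (omeas A).
Proof. intros HA. now destruct (omeas_spec A r HA) as [H _]. Qed.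

(** * Caratheodory measurability of intervals *)

Lemma lmeasurable_inter (A B : R -> Prop) :
  lmeasurable A -> lmeasurable B -> lmeasurable (fun x => A x /\ B x).
Proof.
  intros HA HB E r HE.
  destruct (HA E r HE) as (p & q & Hp & Hq & Hpq).
  destruct (HB _ p Hp) as (p1 & p2 & Hp1 & Hp2 & Hp12).
  exists p1, (p2 + q). split; [|split; [|lra]].
  - eapply outer_le_mono; [|apply Rle_refl|exact Hp1]. cbv beta; tauto.
  - eapply outer_le_union; [|exact Hp2|exact Hq].
    cbv beta. intros x [Hx Hn]. destruct (classic (A x)); tauto.
Qed.

(** Cutting every interval of a cover at [c] yields covers of the two pieces with the same total
    length. *)
Lemma lmeasurable_lt (c : R) : lmeasurable (fun x => x < c).
Proof.
  intros E r HE.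
  assert (HL : outer_le (fun x => E x /\ x < c) r).
  { eapply outer_le_mono; [|apply Rle_refl|exact HE]. cbv beta; tauto. }
  assert (HG : outer_le (fun x => E x /\ ~ x < c) r).
  { eapply outer_le_mono; [|apply Rle_refl|exact HE]. cbv beta; tauto. }
  (* Measurability leaves no slack in [r1 + r2 <= r], so the witnesses must be fixed before the
     cover, which depends on [eps]. *)
  exists (omeas (fun x => E x /\ x < c)), (omeas (fun x => E x /\ ~ x < c)).
  split; [exact (omeas_outer _ _ HL)|split; [exact (omeas_outer _ _ HG)|]].
  apply Rle_plus_epsilon. intros eps Heps.
  destruct (HE eps Heps) as (a & b & Hab & Hcov & Hsum).
  pose (u1 := fun k => Rmin (b k) c - Rmin (a k) c).
  pose (u2 := fun k => Rmax (b k) c - Rmax (a k) c).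
  assert (Hu1 : forall k, 0 <= u1 k).
  { intros k; specialize (Hab k); unfold u1, Rmin.
    destruct (Rle_dec (b k) c), (Rle_dec (a k) c); lra. }
  assert (Hu2 : forall k, 0 <= u2 k).
  { intros k; specialize (Hab k); unfold u2, Rmax.
    destruct (Rle_dec (b k) c), (Rle_dec (a k) c); lra. }
  assert (Hu : forall N, sum_f_R0 u1 N + sum_f_R0 u2 N <= r + eps).
  { intros N. rewrite <- sum_plus.
    rewrite (sum_eq _ (fun k => b k - a k)); [apply Hsum|].
    intros k _; specialize (Hab k); unfold u1, u2, Rmin, Rmax.
    destruct (Rle_dec (b k) c), (Rle_dec (a k) c); lra. }
  (* Independent indices allow the supremum to be taken in each series separately. *)
  assert (Hu12 : forall N N', sum_f_R0 u1 N + sum_f_R0 u2 N' <= r + eps).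
  { intros N N'. specialize (Hu (Nat.max N N')).
    pose proof (sum_nonneg_mono u1 N (Nat.max N N') Hu1 ltac:(lia)).
    pose proof (sum_nonneg_mono u2 N' (Nat.max N N') Hu2 ltac:(lia)). lra. }
  assert (Hlub : forall u C, (forall N, sum_f_R0 u N <= C) ->
     exists l, is_lub (fun x => exists N, x = sum_f_R0 u N) l).
  { intros u C HC. destruct (completeness (fun x => exists N, x = sum_f_R0 u N)) as [l Hl].
    - exists C. intros x [N ->]; auto.
    - exists (sum_f_R0 u 0), O; reflexivity.
    - now exists l. }
  destruct (Hlub u1 (r + eps - u2 O)) as (l1 & Hub1 & Hl1).
  { intros N. specialize (Hu12 N O). simpl in Hu12; lra. }
  destruct (Hlub u2 (r + eps - u1 O)) as (l2 & Hub2 & Hl2).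
  { intros N. specialize (Hu12 O N). simpl in Hu12; lra. }
  assert (Hl12 : l1 + l2 <= r + eps).
  { assert (l1 <= r + eps - l2); [|lra].
    apply Hl1. intros x [N ->].
    assert (l2 <= r + eps - sum_f_R0 u1 N); [|lra].
    apply Hl2. intros y [N' ->]. specialize (Hu12 N N'); lra. }
  assert (H1 : outer_le (fun x => E x /\ x < c) l1).
  { intros e He. exists (fun k => Rmin (a k) c), (fun k => Rmin (b k) c).
    split; [|split].
    - intros k; specialize (Hu1 k); unfold u1 in Hu1; lra.
    - intros x [Hx Hxc]. destruct (Hcov x Hx) as [n Hn]. exists n.
      unfold Rmin; destruct (Rle_dec (b n) c), (Rle_dec (a n) c); lra.
    - intros N. specialize (Hub1 (sum_f_R0 u1 N) (ex_intro _ N eq_refl)).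
      unfold u1 in Hub1; lra. }
  assert (H2 : outer_le (fun x => E x /\ c < x) l2).
  { intros e He. exists (fun k => Rmax (a k) c), (fun k => Rmax (b k) c).
    split; [|split].
    - intros k; specialize (Hu2 k); unfold u2 in Hu2; lra.
    - intros x [Hx Hxc]. destruct (Hcov x Hx) as [n Hn]. exists n.
      unfold Rmax; destruct (Rle_dec (b n) c), (Rle_dec (a n) c); lra.
    - intros N. specialize (Hub2 (sum_f_R0 u2 N) (ex_intro _ N eq_refl)).
      unfold u2 in Hub2; lra. }
  (* The open right-hand pieces miss the point [c]; a degenerate interval of length [c - c] restores
     it. *)
  assert (H2' : outer_le (fun x => E x /\ ~ x < c) (l2 + (c - c))).
  { eapply outer_le_union; [|exact H2|apply (outer_le_interval c c); lra].
    cbv beta. intros x [Hx Hxc]. destruct (Req_dec x c);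
      [right; lra|left; split; [assumption|lra]]. }
  apply omeas_le in H1; apply omeas_le in H2'; lra.
Qed.

Lemma lmeasurable_compl (A : R -> Prop) : lmeasurable A -> lmeasurable (fun x => ~ A x).
Proof.
  intros HA E r HE. destruct (HA E r HE) as (p & q & Hp & Hq & Hpq).
  exists q, p. split; [exact Hq|split; [|lra]].
  eapply outer_le_mono; [|apply Rle_refl|exact Hp].
  cbv beta. intros x [Hx Hn]. split; [exact Hx|now apply NNPP].
Qed.

Lemma lmeasurable_Ico (a b : R) : lmeasurable (fun x => ~ x < a /\ x < b).
Proof.
  apply lmeasurable_inter; [apply lmeasurable_compl|]; apply lmeasurable_lt.
Qed.

(** * Simple functions and their integrals over arbitrary sets *)

Definition sval (s : list (R * (R -> Prop) * R)) (x : R) : R :=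
  fold_right (fun t acc => let '(c, A, _) := t in c * ind A x + acc) 0 s.

(** The measure stored in the list is that of the whole set, so the one of its trace on [E] is
    recomputed. As [E] is arbitrary, only subadditivity in [E] is established. *)
Definition int_on (s : list (R * (R -> Prop) * R)) (E : R -> Prop) : R :=
  fold_right (fun t acc => let '(c, A, _) := t in
                c * omeas (fun x => A x /\ E x) + acc) 0 s.

Definition csum (s : list (R * (R -> Prop) * R)) : R :=
  fold_right (fun t acc => let '(c, _, _) := t in c + acc) 0 s.

Definition simple_pos (s : list (R * (R -> Prop) * R)) : Prop :=
  Forall (fun t => let '(c, A, _) := t in 0 <= c /\ lmeasurable A) s.

Lemma ind_bounds (A : R -> Prop) (x : R) : 0 <= ind A x <= 1.
Proof. unfold ind; destruct (excluded_middle_informative (A x)); lra. Qed.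

Lemma ind_in (A : R -> Prop) (x : R) : A x -> ind A x = 1.
Proof. unfold ind; now destruct (excluded_middle_informative (A x)). Qed.

Lemma ind_out (A : R -> Prop) (x : R) : ~ A x -> ind A x = 0.
Proof. unfold ind; now destruct (excluded_middle_informative (A x)). Qed.

Lemma sval_bounds s x : simple_pos s -> 0 <= sval s x <= csum s.
Proof.
  intros H. induction H as [|[[c A] m] s [Hc _] _ IH]; simpl; [lra|].
  pose proof (ind_bounds A x). nra.
Qed.

Lemma csum_nonneg s : simple_pos s -> 0 <= csum s.
Proof. intros H. pose proof (sval_bounds s 0 H). lra. Qed.

Lemma outer_le_inter_r (A E : R -> Prop) r :
  outer_le E r -> outer_le (fun x => A x /\ E x) r.
Proof. apply outer_le_mono; [tauto|lra]. Qed.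

Lemma int_on_union s (E E1 E2 : R -> Prop) r1 r2 :
  simple_pos s -> outer_le E1 r1 -> outer_le E2 r2 ->
  (forall x, E x -> E1 x \/ E2 x) -> int_on s E <= int_on s E1 + int_on s E2.
Proof.
  intros Hs H1 H2 HE. induction Hs as [|[[c A] m] s [Hc _] _ IH]; simpl; [lra|].
  assert (omeas (fun x => A x /\ E x) <=
          omeas (fun x => A x /\ E1 x) + omeas (fun x => A x /\ E2 x)).
  { apply omeas_le.
    eapply outer_le_union;
      [|eapply omeas_outer, outer_le_inter_r, H1
       |eapply omeas_outer, outer_le_inter_r, H2].
    cbv beta; intros x [? ?]; destruct (HE x); tauto. }
  nra.
Qed.

(* Split [E] along the first set [A] of the list: on [E /\ A] the remaining
   list is bounded by [M - c], off [A] by [M].  Only Caratheodory's condition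
   for the sets of the list is used, never additivity of the measure. *)
Lemma int_on_bound s : simple_pos s -> forall (E : R -> Prop) r M,
  outer_le E r -> 0 <= M -> (forall x, E x -> sval s x <= M) ->
  int_on s E <= M * r.
Proof.
  intros Hs. induction Hs as [|[[c A] m] s [Hc HA] Hs IH]; intros E r M HE HM Hb; simpl.
  - apply outer_le_nonneg in HE. nra.
  - destruct (HA E r HE) as (r1 & r2 & H1 & H2 & H12).
    assert (Hout : int_on s (fun x => E x /\ ~ A x) <= M * r2).
    { apply IH; auto. intros x [Hx Hn]. specialize (Hb x Hx). simpl in Hb.
      rewrite (ind_out A x Hn) in Hb. fold (sval s x) in Hb. lra. }
    assert (Hsplit : int_on s E <=
      int_on s (fun x => E x /\ A x) + int_on s (fun x => E x /\ ~ A x)).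
    { eapply int_on_union; eauto. cbv beta. intros x Hx; destruct (classic (A x)); tauto. }
    assert (HAE : omeas (fun x => A x /\ E x) <= r1).
    { apply omeas_le. eapply outer_le_mono; [|apply Rle_refl|exact H1]. cbv beta; tauto. }
    pose proof (outer_le_nonneg _ _ H1) as Hr1.
    pose proof (outer_le_nonneg _ _ H2) as Hr2.
    fold (int_on s E).
    (* A common point of [E] and [A] gives [c <= M], so that the induction hypothesis applies with
       [M - c]. Without one, the piece has measure 0. *)
    destruct (classic (exists x, E x /\ A x)) as [[x0 [Hx0 Ax0]]|Hno].
    + assert (Hcb : forall x, E x /\ A x -> sval s x <= M - c).
      { intros x [Hx Ax]. specialize (Hb x Hx). simpl in Hb.
        rewrite (ind_in A x Ax) in Hb. fold (sval s x) in Hb. lra. }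
      assert (HcM : 0 <= M - c).
      { specialize (Hcb x0 (conj Hx0 Ax0)). pose proof (sval_bounds s x0 Hs). lra. }
      pose proof (IH _ _ _ H1 HcM Hcb). nra.
    + assert (H0 : outer_le (fun x => E x /\ A x) 0).
      { apply outer_le_empty. intros x Hx; apply Hno; eauto. }
      assert (omeas (fun x => A x /\ E x) <= 0).
      { apply omeas_le. eapply outer_le_mono; [|apply Rle_refl|exact H0]. cbv beta; tauto. }
      pose proof (IH _ _ M H0 HM ltac:(intros x Hx; exfalso; apply Hno; exists x; exact Hx)). nra.
Qed.

(** * Simple minorants and the Lebesgue integral *)

Definition supported_simple (a b : R) (s : list (R * (R -> Prop) * R)) : Prop :=
  Forall (fun t => let '(c, A, m) := t in
            0 <= c /\ lmeasurable A /\ measure_is A m /\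
            (forall x, A x -> a < x < b)) s.

Lemma supported_simple_pos a b s : supported_simple a b s -> simple_pos s.
Proof. apply Forall_impl. intros [[c A] m]; tauto. Qed.

Lemma outer_le_open (a b : R) : a <= b -> outer_le (fun x => a < x < b) (b - a).
Proof.
  intros Hab. eapply outer_le_mono; [|apply Rle_refl|apply outer_le_interval, Hab].
  cbv beta; intros; lra.
Qed.

Lemma minorant_value_le_int_on a b s :
  a <= b -> supported_simple a b s ->
  fold_right (fun t acc => let '(c, _, m) := t in c * m + acc) 0 s
  <= int_on s (fun x => a < x < b).
Proof.
  intros Hab Hs. induction Hs as [|[[c A] m] s (Hc & HA & [Hm Hinf] & Hsub) _ IH]; simpl; [lra|].
  fold (int_on s (fun x => a < x < b)).
  assert (m <= omeas (fun x => A x /\ a < x < b)).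
  { apply Hinf. eapply outer_le_mono;
      [|apply Rle_refl
       |eapply omeas_outer, outer_le_inter_r, outer_le_open, Hab].
    cbv beta. intros x Hx; split; auto. }
  nra.
Qed.

(** Passing from minorant values to [int_on] permits cutting the interval by [int_on_union] when an
    integral is bounded from above. *)
Lemma leb_int_le f a b I B :
  a <= b -> leb_int f a b I ->
  (forall s, supported_simple a b s -> (forall x, a < x < b -> sval s x <= f x) ->
     int_on s (fun x => a < x < b) <= B) ->
  I <= B.
Proof.
  intros Hab [_ Hlub] H. apply Hlub. intros v (s & Hs & Hle & ->).
  eapply Rle_trans; [apply minorant_value_le_int_on|apply H]; eauto.
Qed.

(** Scaling the coefficients by [k] and intersecting the sets with [H] turns [s] into [k] times its
    restriction to [H]. In this way a minorant of one integrand becomes a minorant of another one,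
    to which it compares only on [H]. *)
Lemma restricted_minorant a b s (H : R -> Prop) k f :
  a <= b -> supported_simple a b s -> lmeasurable H -> 0 <= k ->
  (forall x, a < x < b -> 0 <= f x) ->
  (forall x, a < x < b -> H x -> k * sval s x <= f x) ->
  simple_minorant_val f a b (k * int_on s H).
Proof.
  intros Hab Hs HH Hk Hf Hle.
  pose (g := fun t : R * (R -> Prop) * R => let '(c, A, _) := t in
               (k * c, fun x => A x /\ H x, omeas (fun x => A x /\ H x))).
  exists (map g s). split; [|split].
  - clear Hf Hle. induction Hs as [|[[c A] m] s (Hc & HA & Hm & Hsub) _ IH];
      simpl; constructor; auto.
    split; [nra|]. split; [now apply lmeasurable_inter|]. split.
    + destruct Hm as [Hm _]. eapply omeas_spec.
      eapply outer_le_mono; [|apply Rle_refl|exact Hm]. cbv beta; tauto.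
    + intros x [Ax _]; auto.
  - intros x Hx.
    apply Rle_trans with (k * (ind H x * sval s x)).
    + apply Req_le. clear. induction s as [|[[c A] m] s IH]; simpl; [ring|].
      rewrite IH. unfold sval, ind.
      destruct (excluded_middle_informative (A x)), (excluded_middle_informative (H x)),
        (excluded_middle_informative (A x /\ H x)); try tauto; ring.
    + destruct (classic (H x)) as [Hx'|Hx'].
      * rewrite ind_in, Rmult_1_l by auto. auto.
      * rewrite ind_out by auto. specialize (Hf x Hx). lra.
  - clear. induction s as [|[[c A] m] s IH]; simpl; [ring|].
    rewrite <- IH. unfold int_on. ring.
Qed.

Lemma simple_minorant_zero f a b :
  (forall x, a < x < b -> 0 <= f x) -> simple_minorant_val f a b 0.
Proof. intros Hf. exists nil. repeat split; auto. Qed.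

Lemma leb_int_nonneg f a b I :
  (forall x, a < x < b -> 0 <= f x) -> leb_int f a b I -> 0 <= I.
Proof. intros Hf [Hub _]. now apply Hub, simple_minorant_zero. Qed.

Lemma leb_int_le_const f a b I M :
  a <= b -> 0 <= M -> (forall x, a < x < b -> f x <= M) -> leb_int f a b I ->
  I <= M * (b - a).
Proof.
  intros Hab HM Hf HI. apply (leb_int_le f a b I _ Hab HI).
  intros s Hs Hle. eapply int_on_bound; auto.
  - eapply supported_simple_pos, Hs.
  - now apply outer_le_open.
  - intros x Hx. eapply Rle_trans; [apply Hle|apply Hf]; auto.
Qed.

Lemma leb_int_exists f a b M :
  a <= b -> 0 <= M -> (forall x, a < x < b -> 0 <= f x <= M) ->
  exists I, leb_int f a b I.
Proof.
  intros Hab HM Hf.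
  destruct (completeness (simple_minorant_val f a b)) as [I HI].
  - exists (M * (b - a)). intros v (s & Hs & Hle & ->).
    eapply Rle_trans; [exact (minorant_value_le_int_on a b s Hab Hs)|].
    eapply int_on_bound; auto.
    + eapply supported_simple_pos, Hs.
    + now apply outer_le_open.
    + intros x Hx. eapply Rle_trans; [apply Hle|apply Hf]; auto.
  - exists 0. apply simple_minorant_zero. intros x Hx; now apply Hf.
  - now exists I.
Qed.

(** * Bounds for the kernel *)

(** With [y = x / 2], the mean value theorem gives [sin y >= y * cos y], so
    [sin x >= x * cos y ^ 2], and [cos x >= 0] means [cos y ^ 2 >= 1 / 2]. *)
Lemma sin_ge_half x : 0 <= x <= PI / 2 -> x / 2 <= sin x.
Proof.
  intros Hx. destruct (Req_dec x 0) as [->|Hx0]; [rewrite sin_0; lra|].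
  pose proof PI_RGT_0 as HPI.
  destruct (MVT_cor2 (fun y => sin y - y * cos y) (fun y => y * sin y) 0 (x / 2))
    as (c & Heq & Hc); [lra| |].
  { intros c _. apply is_derive_Reals. auto_derive; [trivial|ring]. }
  rewrite sin_0 in Heq.
  assert (0 <= sin c) by (apply sin_ge_0; lra).
  assert (H1 : x / 2 * cos (x / 2) <= sin (x / 2)).
  { assert (0 <= c * sin c * (x / 2 - 0)) by (repeat apply Rmult_le_pos; lra). lra. }
  assert (H2 : 0 <= cos (x / 2)) by (apply cos_ge_0; lra).
  assert (H3 : 0 <= cos x) by (apply cos_ge_0; lra).
  replace x with (2 * (x / 2)) in H3 |- * by field.
  rewrite cos_2a_cos in H3. rewrite sin_2a. nra.
Qed.

Lemma ln_sin_ratio t d : 0 < d < t -> t < PI / 2 ->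
  exists xi, 0 < xi < d /\
    ln (sin (t + d) / sin (t - d)) =
    d * (2 * sin t * cos t / (sin t ^ 2 - sin xi ^ 2)).
Proof.
  intros Hd Ht.
  assert (Hpos : forall x, 0 <= x <= d -> 0 < sin (t + x) /\ 0 < sin (t - x)).
  { intros x Hx; split; apply sin_gt_0; lra. }
  destruct (MVT_cor2 (fun x => ln (sin (t + x)) - ln (sin (t - x)))
     (fun x => cos (t + x) / sin (t + x) + cos (t - x) / sin (t - x)) 0 d)
    as (c & Heq & Hc); [lra| |].
  { intros c Hc. destruct (Hpos c Hc). apply is_derive_Reals.
    auto_derive; [repeat split; assumption|].
    unfold Rminus. field. split; apply Rgt_not_eq; assumption. }
  exists c; split; [exact Hc|].
  destruct (Hpos d) as [Ha Hb]; [lra|].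
  unfold Rdiv at 1. rewrite ln_mult, ln_Rinv by (try apply Rinv_0_lt_compat; assumption).
  rewrite !Rplus_0_r, !Rminus_0_r in Heq.
  replace (ln (sin (t + d)) + - ln (sin (t - d)))
    with ((cos (t + c) / sin (t + c) + cos (t - c) / sin (t - c)) * d) by lra.
  destruct (Hpos c) as [Hp Hm]; [lra|].
  assert (Hprod : sin t ^ 2 - sin c ^ 2 = sin (t + c) * sin (t - c)).
  { rewrite sin_plus, sin_minus.
    pose proof (sin2_cos2 t) as E1; pose proof (sin2_cos2 c) as E2; unfold Rsqr in *.
    assert (E3 : cos t * cos t = 1 - sin t * sin t) by lra.
    assert (E4 : cos c * cos c = 1 - sin c * sin c) by lra.
    replace ((sin t * cos c + cos t * sin c) * (sin t * cos c - cos t * sin c))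
      with (sin t * sin t * (cos c * cos c) - cos t * cos t * (sin c * sin c)) by ring.
    rewrite E3, E4. ring. }
  assert (Hsum : 2 * sin t * cos t = cos (t + c) * sin (t - c) + cos (t - c) * sin (t + c)).
  { rewrite <- sin_2a. replace (2 * t) with ((t + c) + (t - c)) by ring.
    rewrite sin_plus. ring. }
  rewrite Hprod, Hsum. field. split; apply Rgt_not_eq; assumption.
Qed.

Lemma Kern_reflect s sigma : 0 < s < sigma -> sigma < PI / 2 ->
  Kern s sigma =
  ln (sin ((PI / 2 - s) + (PI / 2 - sigma)) / sin ((PI / 2 - s) - (PI / 2 - sigma))).
Proof.
  intros Hs Hsig. unfold Kern. f_equal.
  replace (PI / 2 - s + (PI / 2 - sigma)) with (PI - (s + sigma)) by lra.
  replace (PI / 2 - s - (PI / 2 - sigma)) with (- (s - sigma)) by lra.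
  rewrite sin_PI_x, sin_neg.
  assert (0 < sin (s + sigma)) by (apply sin_gt_0; lra).
  assert (0 < sin (- (s - sigma))) by (apply sin_gt_0; lra).
  rewrite sin_neg in *.
  unfold Rdiv. rewrite Rabs_mult, Rabs_inv, (Rabs_right (sin (s + sigma))), Rabs_left by lra.
  reflexivity.
Qed.

Lemma Kern_mvt s sigma : 0 < s < sigma -> sigma < PI / 2 ->
  exists xi, 0 < xi < PI / 2 - sigma /\
    Kern s sigma =
    (PI / 2 - sigma) * (2 * cos s * sin s / (cos s ^ 2 - sin xi ^ 2)).
Proof.
  intros Hs Hsig. rewrite Kern_reflect by lra.
  destruct (ln_sin_ratio (PI / 2 - s) (PI / 2 - sigma)) as (xi & Hxi & ->); [lra|lra|].
  exists xi; split; [exact Hxi|].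
  now rewrite sin_shift, cos_shift.
Qed.

Lemma sin_sq_lt_cos_sq s x : 0 < s -> 0 < x < PI / 2 - s -> sin x ^ 2 < cos s ^ 2.
Proof.
  intros Hs Hx. rewrite <- sin_shift.
  assert (0 < sin x) by (apply sin_gt_0; lra).
  assert (sin x < sin (PI / 2 - s)) by (apply sin_increasing_1; lra).
  nra.
Qed.

Lemma Kern_lower s sigma : 0 < s < sigma -> sigma < PI / 2 ->
  (PI / 2 - sigma) * (2 * (sin s / cos s)) <= Kern s sigma.
Proof.
  intros Hs Hsig. destruct (Kern_mvt s sigma Hs Hsig) as (xi & Hxi & ->).
  assert (0 < cos s) by (apply cos_gt_0; lra).
  assert (0 < sin s) by (apply sin_gt_0; lra).
  assert (Hlt : sin xi ^ 2 < cos s ^ 2) by (apply sin_sq_lt_cos_sq; lra).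
  apply Rmult_le_compat_l; [lra|].
  replace (2 * (sin s / cos s)) with (2 * cos s * sin s / cos s ^ 2) by (field; lra).
  apply Rmult_le_compat_l; [assert (0 < cos s * sin s) by (now apply Rmult_lt_0_compat); lra|].
  pose proof (pow2_ge_0 (sin xi)).
  apply Rinv_le_contravar; lra.
Qed.

(** With [d = PI / 2 - sigma], the smallness hypothesis amounts to [cos s ^ 2 <= (1 + e) * (cos s ^
    2 - d ^ 2)], and [sin xi <= d]. *)
Lemma Kern_upper s sigma e : 0 < s < sigma -> sigma < PI / 2 -> 0 < e ->
  (1 + e) * (PI / 2 - sigma) ^ 2 <= e * cos s ^ 2 ->
  Kern s sigma <= (1 + e) * ((PI / 2 - sigma) * (2 * (sin s / cos s))).
Proof.
  intros Hs Hsig He Hsmall. destruct (Kern_mvt s sigma Hs Hsig) as (xi & Hxi & ->).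
  assert (0 < cos s) by (apply cos_gt_0; lra).
  assert (0 < sin s) by (apply sin_gt_0; lra).
  assert (Hlt : sin xi ^ 2 < cos s ^ 2) by (apply sin_sq_lt_cos_sq; lra).
  assert (0 < sin xi) by (apply sin_gt_0; lra).
  assert (sin xi < xi) by (apply sin_lt_x; lra).
  assert (Hsq : sin xi ^ 2 <= (PI / 2 - sigma) ^ 2) by (apply pow_incr; lra).
  replace ((1 + e) * ((PI / 2 - sigma) * (2 * (sin s / cos s))))
    with ((PI / 2 - sigma) * (2 * (sin s / cos s) * (1 + e))) by ring.
  apply Rmult_le_compat_l; [lra|].
  replace (2 * (sin s / cos s) * (1 + e))
    with (2 * cos s * sin s * ((1 + e) / cos s ^ 2)) by (field; lra).
  apply Rmult_le_compat_l; [assert (0 < cos s * sin s) by (now apply Rmult_lt_0_compat); lra|].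
  assert (Hd : 0 < cos s ^ 2 - sin xi ^ 2) by lra.
  assert (Hc : 0 < cos s ^ 2) by (apply pow_lt; assumption).
  apply Rmult_le_reg_r with (cos s ^ 2 - sin xi ^ 2); [exact Hd|].
  rewrite Rinv_l by lra.
  apply Rmult_le_reg_r with (cos s ^ 2); [exact Hc|].
  replace ((1 + e) / cos s ^ 2 * (cos s ^ 2 - sin xi ^ 2) * cos s ^ 2)
    with ((1 + e) * (cos s ^ 2 - sin xi ^ 2)) by (field; lra).
  nra.
Qed.

(** On the diagonal the conventions [/ 0 = 0] and [ln 0 = 0] replace the infinite value. *)
Lemma Kern_diag s : Kern s s = 0.
Proof.
  unfold Kern. rewrite Rminus_diag, sin_0. unfold Rdiv.
  rewrite Rinv_0, Rmult_0_r, Rabs_R0.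
  unfold ln. destruct (Rlt_dec 0 0) as [H|H]; [destruct (Rlt_irrefl 0 H)|reflexivity].
Qed.

Lemma Kern_endpoint s : 0 < s < PI / 2 -> Kern s (PI / 2) = 0.
Proof.
  intros Hs. unfold Kern.
  replace (s - PI / 2) with (- (PI / 2 - s)) by ring.
  rewrite sin_neg, sin_shift, Rplus_comm, <- cos_sin.
  assert (0 < cos s) by (apply cos_gt_0; lra).
  replace (cos s / - cos s) with (-1) by (field; lra).
  rewrite Rabs_left by lra. replace (- -1) with 1 by ring. apply ln_1.
Qed.

Lemma Kern_nonneg s sigma : 0 < s < PI / 2 -> 0 < sigma < PI / 2 -> 0 <= Kern s sigma.
Proof.
  intros Hs Hsig. destruct (Req_dec s sigma) as [->|Hne]; [rewrite Kern_diag; lra|].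
  assert (Hnum : Rabs (sin (s - sigma)) <= sin (s + sigma)).
  { rewrite sin_plus, sin_minus.
    assert (0 < cos s) by (apply cos_gt_0; lra).
    assert (0 < cos sigma) by (apply cos_gt_0; lra).
    assert (0 < sin s) by (apply sin_gt_0; lra).
    assert (0 < sin sigma) by (apply sin_gt_0; lra).
    assert (0 < sin s * cos sigma) by now apply Rmult_lt_0_compat.
    assert (0 < cos s * sin sigma) by now apply Rmult_lt_0_compat.
    apply Rabs_le; lra. }
  assert (Hden : 0 < Rabs (sin (s - sigma))).
  { apply Rabs_pos_lt. destruct (Rtotal_order s sigma) as [H|[H|H]]; [|contradiction|].
    - assert (0 < sin (- (s - sigma))) by (apply sin_gt_0; lra).
      rewrite sin_neg in *; lra.
    - assert (0 < sin (s - sigma)) by (apply sin_gt_0; lra). lra. }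
  unfold Kern. rewrite <- ln_1. apply ln_le; [lra|].
  unfold Rdiv. rewrite Rabs_mult, Rabs_inv, (Rabs_right (sin (s + sigma))) by lra.
  apply Rmult_le_reg_r with (Rabs (sin (s - sigma))); [exact Hden|].
  rewrite Rmult_assoc, Rinv_l by lra. lra.
Qed.

(** Trades the logarithmic singularity for an inverse square root, which behaves well under
    scaling. *)
Lemma ln_le_2_sqrt x : 0 < x -> ln x <= 2 * sqrt x.
Proof.
  intros Hx. assert (H : 0 < sqrt x) by now apply sqrt_lt_R0.
  rewrite <- (sqrt_sqrt x) at 1 by lra. rewrite ln_mult by assumption.
  pose proof (exp_ineq1_le (ln (sqrt x))) as He. rewrite exp_ln in He by assumption. lra.
Qed.

(** The numerator is at most [h] since [sin (s + sigma) = sin (PI - (s + sigma))], and the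
    denominator is at least half of [Rabs (s - sigma)]. The factor [sqrt (2 * h)] records the
    smallness near the corner where both variables approach [PI / 2]. *)
Lemma Kern_sqrt_bound s sigma h : 0 < s < PI / 2 -> 0 < sigma < PI / 2 ->
  s <> sigma -> PI - (s + sigma) <= h ->
  Kern s sigma <= 2 * sqrt (2 * h) / sqrt (Rabs (s - sigma)).
Proof.
  intros Hs Hsig Hne Hh.
  assert (Hd : 0 < Rabs (s - sigma)) by (apply Rabs_pos_lt; lra).
  assert (Hden : Rabs (s - sigma) / 2 <= Rabs (sin (s - sigma))).
  { destruct (Rtotal_order s sigma) as [H|[H|H]]; [|contradiction|].
    - rewrite (Rabs_left (s - sigma)), <- Rabs_Ropp, <- sin_neg by lra.
      eapply Rle_trans; [apply sin_ge_half; lra|apply Rle_abs].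
    - rewrite (Rabs_right (s - sigma)) by lra.
      eapply Rle_trans; [apply sin_ge_half; lra|apply Rle_abs]. }
  assert (Hnum0 : 0 < sin (s + sigma)) by (apply sin_gt_0; lra).
  assert (Hnum : sin (s + sigma) <= h).
  { rewrite <- sin_PI_x. left. eapply Rlt_le_trans; [apply sin_lt_x; lra|exact Hh]. }
  unfold Kern. unfold Rdiv at 1.
  rewrite Rabs_mult, Rabs_inv, (Rabs_right (sin (s + sigma))) by lra.
  assert (Hinv : 0 < / Rabs (sin (s - sigma))) by (apply Rinv_0_lt_compat; lra).
  eapply Rle_trans; [apply ln_le_2_sqrt, Rmult_lt_0_compat; assumption|].
  unfold Rdiv; rewrite Rmult_assoc. apply Rmult_le_compat_l; [lra|].
  change (sqrt (2 * h) * / sqrt (Rabs (s - sigma))) with (sqrt (2 * h) / sqrt (Rabs (s - sigma))).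
  rewrite <- sqrt_div by lra.
  apply sqrt_le_1_alt.
  replace (2 * h / Rabs (s - sigma)) with (h * / (Rabs (s - sigma) / 2)) by (field; lra).
  apply Rmult_le_compat; try lra.
  apply Rinv_le_contravar; lra.
Qed.

(** * Behaviour at the right endpoint *)

(* Shells [r / 4 < |x - sigma| <= r], iterated: the shells contribute a geometric
   series, and the remaining core, where only [sval s <= csum s] is known,
   shrinks to nothing. *)
Lemma int_on_sqrt_singularity s (D : R -> Prop) sigma P :
  simple_pos s -> 0 <= P ->
  (forall x, D x -> x <> sigma -> sval s x <= P / sqrt (Rabs (x - sigma))) ->
  forall r, 0 < r ->
  int_on s (fun x => D x /\ Rabs (x - sigma) <= r) <= 8 * P * sqrt r.
Proof.
  intros Hs HP Hb.
  assert (Hout : forall r, 0 < r -> outer_le (fun x => D x /\ Rabs (x - sigma) <= r) (2 * r)).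
  { intros r Hr.
    apply outer_le_mono
      with (fun x => sigma - r <= x <= sigma + r) (sigma + r - (sigma - r)); [|lra|].
    - intros x [_ Hx]. apply Rabs_le_between in Hx. lra.
    - apply outer_le_interval; lra. }
  assert (Hiter : forall n r, 0 < r ->
    int_on s (fun x => D x /\ Rabs (x - sigma) <= r)
    <= 8 * P * sqrt r + csum s * (2 * r) * (/ 4) ^ n).
  { intros n; induction n as [|n IH]; intros r Hr.
    - pose proof (int_on_bound s Hs _ _ (csum s) (Hout r Hr) (csum_nonneg s Hs)
        (fun x _ => proj2 (sval_bounds s x Hs))).
      pose proof (sqrt_pos r).
      assert (0 <= P * sqrt r) by (now apply Rmult_le_pos). simpl; lra.
    - assert (Hr4 : 0 < r / 4) by lra.
      assert (Hsq : sqrt (r / 4) = sqrt r / 2).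
      { rewrite sqrt_div by lra. replace 4 with (2 * 2) by ring. rewrite sqrt_square; lra. }
      assert (Hsqr : 0 < sqrt r) by now apply sqrt_lt_R0.
      assert (Hshell : outer_le (fun x => D x /\ r / 4 < Rabs (x - sigma) <= r) (2 * r)).
      { eapply outer_le_mono; [|apply Rle_refl|apply Hout, Hr]. cbv beta; tauto. }
      assert (Hbound : int_on s (fun x => D x /\ r / 4 < Rabs (x - sigma) <= r)
                       <= P / sqrt (r / 4) * (2 * r)).
      { apply int_on_bound; auto.
        - apply Rmult_le_pos; [lra|]. left; apply Rinv_0_lt_compat; lra.
        - intros x [Dx Hx]. eapply Rle_trans; [apply Hb; auto|].
          + intros ->. rewrite Rminus_diag, Rabs_R0 in Hx. lra.
          + apply Rmult_le_compat_l; [lra|]. apply Rinv_le_contravar; [lra|].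
            apply sqrt_le_1_alt; lra. }
      (* The shell gives [4 * P * sqrt r] and the core, by induction, [8 * P * sqrt (r / 4)], which
         is the same amount; hence the constant 8. *)
      assert (Hval : P / sqrt (r / 4) * (2 * r) = 4 * P * sqrt r).
      { rewrite Hsq. rewrite <- (sqrt_sqrt r) at 2 by lra. field. lra. }
      pose proof (int_on_union s (fun x => D x /\ Rabs (x - sigma) <= r) _ _ _ _ Hs
                    (Hout _ Hr4) Hshell) as Hun.
      cbv beta in Hun.
      assert (Hun' := Hun ltac:(intros x [Dx Hx];
        destruct (Rle_lt_dec (Rabs (x - sigma)) (r / 4)); [left|right]; tauto)).
      specialize (IH (r / 4) Hr4). rewrite Hsq in IH. simpl pow. lra. }
  intros r Hr. apply Rle_plus_epsilon. intros eps Heps.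
  pose proof (csum_nonneg s Hs) as Hc.
  assert (Hc2 : 0 <= csum s * (2 * r)) by (apply Rmult_le_pos; lra).
  destruct (pow_lt_1_zero (/ 4)) with (y := eps / (csum s * (2 * r) + 1)) as [n Hn].
  - rewrite Rabs_right; lra.
  - apply Rdiv_lt_0_compat; lra.
  - specialize (Hn n (le_n n)). rewrite Rabs_right in Hn
      by (apply Rle_ge, pow_le; lra).
    specialize (Hiter n r Hr).
    assert (0 <= (/ 4) ^ n) by (apply pow_le; lra).
    assert ((csum s * (2 * r) + 1) * (/ 4) ^ n < eps); [|lra].
    apply (Rmult_lt_compat_l (csum s * (2 * r) + 1)) in Hn; [|lra].
    replace ((csum s * (2 * r) + 1) * (eps / (csum s * (2 * r) + 1))) with eps in Hn
      by (field; lra).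
    exact Hn.
Qed.

(** * Linear asymptotics of the kernel integral *)

Lemma outer_le_Ico a b : a <= b -> outer_le (fun x => ~ x < a /\ x < b) (b - a).
Proof.
  intros Hab. eapply outer_le_mono; [|apply Rle_refl|apply outer_le_interval, Hab].
  cbv beta; intros; lra.
Qed.

(** A nearly optimal minorant for [I] is fixed first. Cut at [sigma] and scaled by [PI / 2 - sigma],
    it is a minorant of the kernel integrand; the cut loses at most [csum s * (PI / 2 - sigma)]. *)
Lemma Kern_int_lower zeta I eps :
  (forall s, 0 < s < PI / 2 -> 0 <= zeta s) ->
  leb_int (fun s => 2 * (sin s / cos s) * zeta s) 0 (PI / 2) I ->
  0 < eps ->
  exists delta, 0 < delta /\ forall sigma G,
    0 < sigma -> PI / 2 - delta < sigma < PI / 2 ->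
    leb_int (fun s => Kern s sigma * zeta s) 0 (PI / 2) G ->
    (I - eps) * (PI / 2 - sigma) <= G.
Proof.
  intros Hz [_ Hlub] Heps. pose proof PI_RGT_0 as HPI.
  assert (exists s, supported_simple 0 (PI / 2) s /\
    (forall x, 0 < x < PI / 2 -> sval s x <= 2 * (sin x / cos x) * zeta x) /\
    I - eps / 2 < int_on s (fun x => 0 < x < PI / 2)) as (s & Hs & Hle & Hv).
  { apply NNPP. intros Hno. assert (I <= I - eps / 2); [|lra].
    apply Hlub. intros v (s & Hs & Hle & ->).
    apply Rnot_lt_le. intros Hlt. apply Hno. exists s. split; [exact Hs|split; [exact Hle|]].
    eapply Rlt_le_trans; [exact Hlt|]. apply minorant_value_le_int_on; [lra|exact Hs]. }
  assert (Hpos := supported_simple_pos _ _ _ Hs).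
  pose proof (csum_nonneg s Hpos) as Hc.
  exists (eps / (2 * (csum s + 1))). split; [apply Rdiv_lt_0_compat; lra|].
  intros sigma G Hsig0 Hsig [Hub _].
  assert (Hend : csum s * (PI / 2 - sigma) <= eps / 2).
  { apply Rle_trans with ((csum s + 1) * (eps / (2 * (csum s + 1)))).
    - apply Rmult_le_compat; lra.
    - apply Req_le. field. lra. }
  assert (Hlast : int_on s (fun x => sigma <= x <= PI / 2) <= csum s * (PI / 2 - sigma)).
  { apply int_on_bound; auto; [apply outer_le_interval; lra|].
    intros x _. now apply sval_bounds. }
  assert (Hsplit : int_on s (fun x => 0 < x < PI / 2) <=
    int_on s (fun x => ~ x < 0 /\ x < sigma) + int_on s (fun x => sigma <= x <= PI / 2)).
  { eapply int_on_union; [exact Hpos|apply outer_le_Ico; lra|apply outer_le_interval; lra|].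
    intros x Hx. lra. }
  assert (HG : (PI / 2 - sigma) * int_on s (fun x => ~ x < 0 /\ x < sigma) <= G).
  { apply Hub. apply restricted_minorant; auto; try lra.
    - apply lmeasurable_Ico.
    - intros x Hx. apply Rmult_le_pos; [apply Kern_nonneg; lra|auto].
    - intros x Hx [_ Hxs].
      apply Rle_trans with ((PI / 2 - sigma) * (2 * (sin x / cos x)) * zeta x).
      + rewrite Rmult_assoc. apply Rmult_le_compat_l; [lra|auto].
      + apply Rmult_le_compat_r; [auto|]. apply Kern_lower; lra. }
  eapply Rle_trans; [|exact HG]. rewrite Rmult_comm.
  apply Rmult_le_compat_l; lra.
Qed.

(** Each minorant of the kernel integrand is split at [PI / 2 - M * d]. The far part, divided by
    [d * (1 + e)], is a minorant for [I]; the near part is at most [Q * d ^ 2]. *)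
Lemma Kern_int_upper zeta C I eps :
  0 <= C ->
  (forall s, 0 < s < PI / 2 -> 0 <= zeta s <= C * (cos s / sin s)) ->
  leb_int (fun s => 2 * (sin s / cos s) * zeta s) 0 (PI / 2) I ->
  0 < eps ->
  exists delta, 0 < delta /\ forall sigma G,
    0 < sigma -> PI / 2 - delta < sigma < PI / 2 ->
    leb_int (fun s => Kern s sigma * zeta s) 0 (PI / 2) G ->
    G <= (I + eps) * (PI / 2 - sigma).
Proof.
  intros HC Hz HI Heps. pose proof PI_RGT_0 as HPI. pose proof PI2_3_2 as HPI2.
  assert (HW : forall x, 0 < x < PI / 2 -> 0 <= 2 * (sin x / cos x) * zeta x).
  { intros x Hx. apply Rmult_le_pos; [|now apply Hz].
    assert (0 < sin x) by (apply sin_gt_0; lra).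
    assert (0 < cos x) by (apply cos_gt_0; lra).
    assert (0 < sin x / cos x) by (now apply Rdiv_lt_0_compat). lra. }
  assert (HI0 : 0 <= I) by (eapply leb_int_nonneg; [exact HW|exact HI]).
  pose (e := eps / (2 * (I + 1))).
  assert (He : 0 < e) by (apply Rdiv_lt_0_compat; lra).
  assert (HeI : e * I <= eps / 2).
  { replace (eps / 2) with (e * (I + 1)) by (unfold e; field; lra).
    apply Rmult_le_compat_l; lra. }
  (* On the far part [cos x >= M * d / 2], so [e * cos x ^ 2 >= (1 + e) * M * d ^ 2], as
     [Kern_upper] demands. *)
  pose (M := 4 * (1 + e) / e).
  assert (HMe : e * M = 4 * (1 + e)) by (unfold M; field; lra).
  assert (HM : 4 <= M).
  { apply Rmult_le_reg_l with e; [exact He|]. lra. }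
  pose (Q := 64 * C * M * (M + 1)).
  assert (HQ : 0 <= Q) by (unfold Q; repeat (apply Rmult_le_pos; [|lra]); lra).
  (* The first bound gives [M * d <= 1 / 2], so the near part lies in [x >= 1], where
     [sin x >= 1 / 2]; the second gives [Q * d <= eps / 2]. *)
  exists (Rmin (/ (2 * M)) (eps / (2 * (Q + 1)))).
  split.
  { apply Rmin_pos; [apply Rinv_0_lt_compat|apply Rdiv_lt_0_compat]; lra. }
  intros sigma G Hsig0 Hsig HG.
  set (d := PI / 2 - sigma).
  assert (Hd : 0 < d) by (unfold d; lra).
  assert (Hd1 : M * d <= / 2).
  { pose proof (Rmin_l (/ (2 * M)) (eps / (2 * (Q + 1)))).
    replace (/ 2) with (M * / (2 * M)) by (field; lra).
    apply Rmult_le_compat_l; unfold d; lra. }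
  assert (Hd2 : Q * d <= eps / 2).
  { pose proof (Rmin_r (/ (2 * M)) (eps / (2 * (Q + 1)))).
    apply Rle_trans with ((Q + 1) * (eps / (2 * (Q + 1)))).
    - apply Rmult_le_compat; unfold d; lra.
    - apply Req_le. field. lra. }
  refine (leb_int_le _ 0 (PI / 2) G _ _ HG _); [lra|].
  intros s Hs Hle. assert (Hpos := supported_simple_pos _ _ _ Hs).
  pose (D := fun x => PI / 2 - M * d <= x < PI / 2).
  assert (Hfar : / (d * (1 + e)) * int_on s (fun x => ~ x < 0 /\ x < PI / 2 - M * d) <= I).
  { destruct HI as [Hub _]. apply Hub. apply restricted_minorant; auto; try lra.
    - apply lmeasurable_Ico.
    - left; apply Rinv_0_lt_compat, Rmult_lt_0_compat; lra.
    - intros x Hx [_ Hxs].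
      apply Rmult_le_reg_l with (d * (1 + e)); [apply Rmult_lt_0_compat; lra|].
      rewrite <- Rmult_assoc, Rinv_r, Rmult_1_l by (apply Rmult_integral_contrapositive; lra).
      eapply Rle_trans; [apply Hle, Hx|].
      apply Rle_trans with ((1 + e) * (d * (2 * (sin x / cos x))) * zeta x); [|right; ring].
      apply Rmult_le_compat_r; [now apply Hz|].
      apply Kern_upper; [unfold d in *; nra|lra|lra|fold d].
      assert (Hcos : M * d / 2 <= cos x).
      { rewrite <- sin_shift. eapply Rle_trans; [|apply sin_ge_half; lra]. lra. }
      assert (HMd : 0 < M * d) by (apply Rmult_lt_0_compat; lra).
      assert (Hsq : (M * d / 2) ^ 2 <= cos x ^ 2) by (apply pow_incr; lra).
      apply Rle_trans with (e * (M * d / 2) ^ 2); [|apply Rmult_le_compat_l; lra].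
      replace (e * (M * d / 2) ^ 2) with ((e * M) * (M / 4) * d ^ 2) by field.
      rewrite HMe. apply Rmult_le_compat_r; [apply pow2_ge_0|]. nra. }
  (* One factor [d] comes from [zeta x <= C * (2 * M * d)], the other from the two square roots:
     [h = (M + 1) * d] in the kernel bound and the radius [M * d]. *)
  assert (Hnear : int_on s (fun x => D x /\ Rabs (x - sigma) <= M * d)
                  <= 8 * (4 * C * M * d * sqrt (2 * ((M + 1) * d))) * sqrt (M * d)).
  { apply int_on_sqrt_singularity; auto.
    - apply Rmult_le_pos; [|apply sqrt_pos]. repeat (apply Rmult_le_pos; [|lra]); lra.
    - intros x [Hx1 Hx2] Hne.
      assert (Hx : 0 < x < PI / 2) by lra.
      eapply Rle_trans; [apply Hle, Hx|].
      assert (Hsin : / 2 <= sin x).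
      { eapply Rle_trans; [|apply sin_ge_half; lra]. lra. }
      assert (Hcos : 0 <= cos x <= M * d).
      { split; [apply cos_ge_0; lra|]. rewrite <- sin_shift.
        left. eapply Rlt_le_trans; [apply sin_lt_x; lra|lra]. }
      assert (Hzx : zeta x <= C * (M * d * 2)).
      { eapply Rle_trans; [apply Hz, Hx|]. apply Rmult_le_compat_l; [lra|].
        apply Rmult_le_compat; try lra.
        - left; apply Rinv_0_lt_compat; lra.
        - rewrite <- (Rinv_inv 2). apply Rinv_le_contravar; lra. }
      assert (HK : Kern x sigma <= 2 * sqrt (2 * ((M + 1) * d)) / sqrt (Rabs (x - sigma))).
      { apply Kern_sqrt_bound; try lra. unfold d in *; lra. }
      apply Rle_trans with
        (2 * sqrt (2 * ((M + 1) * d)) / sqrt (Rabs (x - sigma)) * (C * (M * d * 2))).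
      + apply Rmult_le_compat; auto; [apply Kern_nonneg; lra|now apply Hz].
      + right. unfold Rdiv; ring.
    - apply Rmult_lt_0_compat; lra. }
  assert (Hroots : sqrt (2 * ((M + 1) * d)) * sqrt (M * d) <= 2 * ((M + 1) * d)).
  { assert (0 < M * d) by (apply Rmult_lt_0_compat; lra).
    rewrite <- (sqrt_sqrt (2 * ((M + 1) * d))) at 2 by lra.
    apply Rmult_le_compat_l; [apply sqrt_pos|]. apply sqrt_le_1_alt; lra. }
  assert (Hnear' : int_on s (fun x => D x /\ Rabs (x - sigma) <= M * d) <= Q * d * d).
  { eapply Rle_trans; [exact Hnear|].
    replace (8 * (4 * C * M * d * sqrt (2 * ((M + 1) * d))) * sqrt (M * d))
      with (32 * (C * (M * d)) * (sqrt (2 * ((M + 1) * d)) * sqrt (M * d))) by ring.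
    replace (Q * d * d) with (32 * (C * (M * d)) * (2 * ((M + 1) * d))) by (unfold Q; ring).
    apply Rmult_le_compat_l; [|exact Hroots].
    repeat (apply Rmult_le_pos; [lra|]); lra. }
  assert (Hsplit : int_on s (fun x => 0 < x < PI / 2) <=
    int_on s (fun x => ~ x < 0 /\ x < PI / 2 - M * d) +
    int_on s (fun x => D x /\ Rabs (x - sigma) <= M * d)).
  { eapply int_on_union with (r2 := PI / 2 - 0); [exact Hpos|apply outer_le_Ico; lra| |].
    - eapply outer_le_mono; [|apply Rle_refl|apply (outer_le_open 0 (PI / 2)); lra].
      unfold D; intros x [Hx _]; lra.
    - intros x Hx. destruct (Rlt_le_dec x (PI / 2 - M * d)) as [H|H]; [left; lra|right].
      unfold D; split; [lra|]. apply Rabs_le. unfold d in *; nra. }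
  assert (Hfar' : int_on s (fun x => ~ x < 0 /\ x < PI / 2 - M * d) <= d * (1 + e) * I).
  { apply (Rmult_le_compat_l (d * (1 + e))) in Hfar; [|apply Rmult_le_pos; lra].
    rewrite <- Rmult_assoc, Rinv_r, Rmult_1_l in Hfar
      by (apply Rmult_integral_contrapositive; lra).
    exact Hfar. }
  assert (Q * d * d <= eps / 2 * d) by (apply Rmult_le_compat_r; lra).
  assert (e * I * d <= eps / 2 * d) by (apply Rmult_le_compat_r; lra).
  lra.
Qed.

Theorem theorem4p8 (alpha : R) (zeta theta Z : R -> R) (N2 : R) :
  alpha0 < alpha ->
  (* zeta in L^2(0,pi/2), non-negative, with ||zeta|| <= 9 sqrt(pi)/2 *)
  measurable_on zeta 0 (PI / 2) ->
  (forall s, 0 < s <= PI / 2 -> 0 <= zeta s) ->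
  leb_int (fun s => zeta s ^ 2) 0 (PI / 2) N2 ->
  sqrt N2 <= 9 * sqrt PI / 2 ->
  (* theta = (1/3) H zeta *)
  (forall sigma, 0 < sigma <= PI / 2 ->
     leb_int (fun s => Kern s sigma * zeta s) 0 (PI / 2) (3 * PI * theta sigma)) ->
  (* Z sigma = int_0^sigma zeta *)
  (forall sigma, 0 < sigma <= PI / 2 -> leb_int zeta 0 sigma (Z sigma)) ->
  (* zeta = Phi(zeta) on (0, pi/2] *)
  (forall sigma, 0 < sigma <= PI / 2 ->
     zeta sigma = 3 / (alpha * PI) *
       (sin (sigma + theta sigma) * (cos sigma / sin sigma)) / exp (Z sigma)) ->
  (forall sigma, 0 < sigma < PI / 2 -> 0 <= sigma + theta sigma <= PI) ->
  let eta := fun sigma => sigma + theta sigma in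
  exists beta : R,
    left_deriv eta (PI / 2) beta /\
    1 - alpha0 / alpha <= beta <= 1 /\
    (forall eps, 0 < eps -> exists delta, 0 < delta /\
       forall sigma, PI / 2 - delta < sigma < PI / 2 ->
         Rabs (eta sigma - (PI / 2 - beta * (PI / 2 - sigma)))
           <= eps * (PI / 2 - sigma)).
Proof.
  intros Halpha _ Hz _ _ Htheta HZ Heq _ eta.
  pose proof PI_RGT_0 as HPI. pose proof PI2_3_2 as HPI2.
  (* This crude bound suffices at the end: [I / (3 * PI)] is at most [1 / (alpha * PI)]. *)
  assert (Ha0 : 1 < alpha0).
  { unfold alpha0. assert (H8 : 0 < sqrt 8) by (apply sqrt_lt_R0; lra).
    assert (H25 : sqrt 8 < 5).
    { replace 5 with (sqrt (5 * 5)) by (apply sqrt_square; lra). apply sqrt_lt_1_alt; lra. }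
    apply Rmult_lt_reg_r with (sqrt 8); [exact H8|].
    replace (5 / sqrt 8 * sqrt 8) with 5 by (field; lra). lra. }
  set (C := 3 / (alpha * PI)).
  assert (HC : 0 < C) by (apply Rdiv_lt_0_compat; [|apply Rmult_lt_0_compat]; lra).
  (* In the fixed point equation the sine is at most 1, and the exponential at least 1 because [Z]
     is non-negative. *)
  assert (Hzb : forall s, 0 < s < PI / 2 -> 0 <= zeta s <= C * (cos s / sin s)).
  { intros s Hs. split; [apply Hz; lra|].
    rewrite Heq by lra. fold C.
    assert (HZ0 : 0 <= Z s).
    { eapply leb_int_nonneg; [|apply HZ; lra]. intros x Hx; apply Hz; lra. }
    assert (Hexp : 1 <= exp (Z s)) by (pose proof (exp_ineq1_le (Z s)); lra).
    assert (Hcot : 0 < cos s / sin s).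
    { apply Rdiv_lt_0_compat; [apply cos_gt_0|apply sin_gt_0]; lra. }
    apply Rmult_le_reg_r with (exp (Z s)); [lra|].
    replace (C * (sin (s + theta s) * (cos s / sin s)) / exp (Z s) * exp (Z s))
      with (C * (cos s / sin s) * sin (s + theta s)).
    2: { field. split; apply Rgt_not_eq; [apply sin_gt_0; lra|apply exp_pos]. }
    apply Rmult_le_compat_l; [apply Rmult_le_pos; lra|].
    destruct (SIN_bound (s + theta s)); lra. }
  pose (W := fun s => 2 * (sin s / cos s) * zeta s).
  assert (HW : forall s, 0 < s < PI / 2 -> 0 <= W s <= 2 * C).
  { intros s Hs. destruct (Hzb s Hs) as [H0 H1].
    assert (Hsin : 0 < sin s) by (apply sin_gt_0; lra).
    assert (Hcos : 0 < cos s) by (apply cos_gt_0; lra).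
    assert (Htan : 0 < sin s / cos s) by (now apply Rdiv_lt_0_compat).
    unfold W. split; [apply Rmult_le_pos; lra|].
    apply (Rmult_le_compat_l (2 * (sin s / cos s))) in H1; [|lra].
    replace (2 * C) with (2 * (sin s / cos s) * (C * (cos s / sin s))) by (field; lra).
    exact H1. }
  destruct (leb_int_exists W 0 (PI / 2) (2 * C)) as [I HI]; [lra|lra|exact HW|].
  assert (HI0 : 0 <= I) by (eapply leb_int_nonneg; [|exact HI]; intros; now apply HW).
  assert (HI1 : I <= 2 * C * (PI / 2 - 0)).
  { eapply leb_int_le_const; [| | |exact HI]; try lra. intros; now apply HW. }
  (* The kernel vanishes identically at [sigma = PI / 2], so its integral is squeezed between 0 and
     0. *)
  assert (Hend : theta (PI / 2) = 0).
  { assert (Hlim := Htheta (PI / 2) ltac:(lra)).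
    assert (Hzero : forall s, 0 < s < PI / 2 -> Kern s (PI / 2) * zeta s = 0).
    { intros s Hs. rewrite Kern_endpoint by exact Hs. ring. }
    assert (0 <= 3 * PI * theta (PI / 2)).
    { eapply leb_int_nonneg; [|exact Hlim]. intros x Hx; cbv beta. rewrite Hzero; auto; lra. }
    assert (3 * PI * theta (PI / 2) <= 0 * (PI / 2 - 0)).
    { eapply leb_int_le_const; [| | |exact Hlim]; try lra.
      intros x Hx; cbv beta. rewrite Hzero; auto; lra. }
    apply Rmult_eq_reg_l with (3 * PI); lra. }
  assert (Hlim : forall eps, 0 < eps -> exists delta, 0 < delta /\
    forall sigma, PI / 2 - delta < sigma < PI / 2 ->
      Rabs (theta sigma - I / (3 * PI) * (PI / 2 - sigma)) <= eps * (PI / 2 - sigma)).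
  { intros eps Heps.
    assert (Heps' : 0 < 3 * PI * eps) by (apply Rmult_lt_0_compat; lra).
    destruct (Kern_int_lower zeta I (3 * PI * eps)) as (d1 & Hd1 & Hlow);
      [intros; apply Hz; lra|exact HI|exact Heps'|].
    destruct (Kern_int_upper zeta C I (3 * PI * eps)) as (d2 & Hd2 & Hup);
      [lra|exact Hzb|exact HI|exact Heps'|].
    (* The 1 keeps [sigma] positive, since [PI / 2 > 3 / 2]. *)
    exists (Rmin 1 (Rmin d1 d2)). split; [repeat apply Rmin_pos; lra|].
    intros sigma Hsig.
    pose proof (Rmin_l 1 (Rmin d1 d2)). pose proof (Rmin_r 1 (Rmin d1 d2)).
    pose proof (Rmin_l d1 d2). pose proof (Rmin_r d1 d2).
    specialize (Hlow sigma _ ltac:(lra) ltac:(lra) (Htheta sigma ltac:(lra))).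
    specialize (Hup sigma _ ltac:(lra) ltac:(lra) (Htheta sigma ltac:(lra))).
    apply Rabs_le.
    replace (theta sigma) with (3 * PI * theta sigma / (3 * PI)) by (field; lra).
    replace (3 * PI * theta sigma / (3 * PI) - I / (3 * PI) * (PI / 2 - sigma))
      with ((3 * PI * theta sigma - I * (PI / 2 - sigma)) / (3 * PI)) by (field; lra).
    split.
    - apply Rle_div_r; lra.
    - apply Rle_div_l; lra. }
  exists (1 - I / (3 * PI)). split; [|split].
  (* Halving [eps] turns the weak inequality of [Hlim] into the strict one of [left_deriv]. *)
  - intros eps Heps. destruct (Hlim (eps / 2)) as (delta & Hdelta & H); [lra|].
    exists delta. split; [exact Hdelta|]. intros x Hx. specialize (H x Hx).
    unfold eta. rewrite Hend.
    replace ((x + theta x - (PI / 2 + 0)) / (x - PI / 2) - (1 - I / (3 * PI)))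
      with (- ((theta x - I / (3 * PI) * (PI / 2 - x)) / (PI / 2 - x))) by (field; lra).
    rewrite Rabs_Ropp, Rabs_div, (Rabs_right (PI / 2 - x)) by lra.
    apply Rle_lt_trans with (eps / 2); [|lra].
    apply Rle_div_l; lra.
  - assert (HCe : 2 * C * (PI / 2 - 0) = 3 / alpha) by (unfold C; field; lra).
    assert (Hpos : 0 <= I / (3 * PI)).
    { apply Rmult_le_pos; [exact HI0|left; apply Rinv_0_lt_compat; lra]. }
    assert (Hup : I / (3 * PI) <= alpha0 / alpha); [|lra].
    rewrite HCe in HI1.
    apply Rle_div_l; [lra|]. eapply Rle_trans; [exact HI1|].
    unfold Rdiv. rewrite (Rmult_comm alpha0), Rmult_assoc, Rmult_comm.
    apply Rmult_le_compat_l; [left; apply Rinv_0_lt_compat; lra|]. nra.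
  - intros eps Heps. destruct (Hlim eps Heps) as (delta & Hdelta & H).
    exists delta. split; [exact Hdelta|]. intros x Hx. specialize (H x Hx).
    unfold eta.
    replace (x + theta x - (PI / 2 - (1 - I / (3 * PI)) * (PI / 2 - x)))
      with (theta x - I / (3 * PI) * (PI / 2 - x)) by (field; lra).
    exact H.
Qed.
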